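(* A (simple, connected) graph $G$ is a double-arborescence if and only if $G$ is a treelike comparability graph that contains no induced subgraph isomorphic to the path $P_4$ on four vertices.
   Context: A graph is a comparability graph if it admits a transitive orientation (whenever $\overrightarrow{ab}$ and $\overrightarrow{bc}$ are arcs, so is $\overrightarrow{ac}$). $G$ is a treelike comparability graph if it admits a transitive orientation whose Hasse diagram (transitive reduction), viewed as an undirected graph, is a tree. A double-arborescence is a treelike comparability graph $G=(V,E)$ having a vertex $r$ adjacent to all other vertices, i.e. $V=\{r\}\cup N_G(r)$. *)

(* Defs.v *)
From mathcomp Require Import all_boot.

Set Implicit Arguments.
Unset Strict Implicit.
Unset Printing Implicit Defensive.

Record sgraph := SGraph {
  svertex :> finType;
  sedge : rel svertex;
  sedge_sym : symmetric sedge;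
  sedge_irrefl : irreflexive sedge }.

Arguments sedge {s} x y.

Definition neighbors (G : sgraph) (x : G) : {set G} := [set y | sedge x y].

(* The graph without vertices is not connected, hence not a tree. *)
Definition connected (G : sgraph) : Prop :=
  0 < #|G| /\ forall x y : G, connect sedge x y.

(* [ucycle] accepts the empty sequence, and the two ends of an edge form a
   [ucycle] of size 2; genuine cycles are those of size at least 3. *)
Definition acyclic (G : sgraph) : Prop :=
  forall c : seq G, 2 < size c -> ~ ucycle sedge c.

Definition is_tree (G : sgraph) : Prop := connected G /\ acyclic G.

Definition iso (G H : sgraph) : Prop :=
  exists f : G -> H,
    bijective f /\ forall x y : G, sedge (f x) (f y) = sedge x y.

Section Induced.
Variables (G : sgraph) (S : {set G}).

Definition induced_rel : rel {x : G | x \in S} :=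
  fun x y => sedge (val x) (val y).

Lemma induced_sym : symmetric induced_rel.
Proof. by move=> x y; rewrite /induced_rel sedge_sym. Qed.

Lemma induced_irrefl : irreflexive induced_rel.
Proof. by move=> x; rewrite /induced_rel sedge_irrefl. Qed.

Definition induced : sgraph := SGraph induced_sym induced_irrefl.
End Induced.

Section PathGraph.
Variable n : nat.

Definition path_rel : rel 'I_n := fun i j => (i.+1 == j) || (j.+1 == i).

Lemma path_sym : symmetric path_rel.
Proof. by move=> i j; rewrite /path_rel orbC. Qed.

Lemma path_irrefl : irreflexive path_rel.
Proof. by move=> i; rewrite /path_rel orbb eqn_leq ltnn. Qed.

Definition path_graph : sgraph := SGraph path_sym path_irrefl.
End PathGraph.

Definition orientation (G : sgraph) (a : rel G) : Prop :=
  (forall x y, sedge x y = a x y || a y x) /\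
  (forall x y, a x y -> ~~ a y x).

Definition transitive_orientation (G : sgraph) (a : rel G) : Prop :=
  orientation a /\ transitive a.

Section Hasse.
Variables (T : finType) (a : rel T).

(* The arcs of the transitive reduction of a transitive orientation. *)
Definition covers : rel T :=
  fun x y => a x y && ~~ [exists z, a x z && a z y].

Definition hasse_rel : rel T := fun x y => covers x y || covers y x.

Lemma hasse_sym : symmetric hasse_rel.
Proof. by move=> x y; rewrite /hasse_rel orbC. Qed.

Lemma hasse_irrefl : irreflexive hasse_rel.
Proof.
move=> x; rewrite /hasse_rel orbb; apply/negP => /andP[axx] /existsP[].
by exists x; rewrite axx.
Qed.

Definition hasse_graph : sgraph := SGraph hasse_sym hasse_irrefl.
End Hasse.

Definition treelike_comparability_graph (G : sgraph) : Prop :=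
  exists a : rel G, transitive_orientation a /\ is_tree (hasse_graph a).

Definition double_arborescence (G : sgraph) : Prop :=
  treelike_comparability_graph G /\
  exists r : G, [set: G] = r |: neighbors r.

(* Main.v *)
Require Import Defs.
From mathcomp Require Import all_boot.

(** Every edge of an acyclic Hasse diagram is a bridge.  Hence an interval is a
    chain, and if [r, z] are incomparable, both below the incomparable
    [x, y], then some [m] satisfies [r, z < m < x, y].

    If [r] is universal, an induced P4 avoids [r] and, its complement being
    connected, lies entirely above or entirely below [r]; a transitive
    orientation of P4 then puts two incomparable vertices in an interval
    bounded by [r].  Conversely, in a P4-free graph a vertex [r] of maximal
    degree is universal: otherwise some [z] at distance two has, up to
    duality, a common upper bound with [r], and a minimal such bound dominates
    [r] and is also adjacent to [z]. *)

Set Implicit Arguments.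
Unset Strict Implicit.
Unset Printing Implicit Defensive.

(** * Bridges of acyclic graphs and extremal elements *)

Definition delete_edge (T : eqType) (e : rel T) (u v : T) : rel T :=
  fun x y => [&& e x y, (x, y) != (u, v) & (x, y) != (v, u)].

Lemma delete_edge_sym (T : eqType) (e : rel T) (u v : T) :
  symmetric e -> symmetric (delete_edge e u v).
Proof.
move=> e_sym x y; rewrite /delete_edge e_sym !xpair_eqE.
by rewrite (andbC (x == u)) (andbC (x == v)) [X in _ && X]andbC.
Qed.

(** A simple path from [u] to [v] avoiding the edge closes up with it to a cycle of length at least
    3. *)
Lemma acyclic_bridge (G : sgraph) (u v : G) :
  acyclic G -> sedge u v -> ~~ connect (delete_edge sedge u v) u v.
Proof.
move=> G_acyclic uv; apply/negP => /connectP[p0 p0_path].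
case/shortenP: p0_path => p p_path p_uniq _ v_last.
apply: (G_acyclic (u :: p)).
  (* An empty path would make [uv] a loop; a one-step path would be the deleted edge. *)
  case: p p_path v_last {p_uniq} => [|w [|w' p]] //= => [_ v_u|].
    by rewrite v_u sedge_irrefl in uv.
  by case/andP=> /and3P[_ /eqP uw _] _ v_w; case: uw; rewrite v_w.
rewrite /ucycle p_uniq andbT /= rcons_path -v_last sedge_sym uv andbT.
by apply: sub_path p_path => x y /and3P[].
Qed.

(** Take a point of [P] with the most predecessors: a point of [P] above it would have one more, [m]
    itself. The reversed relation yields minimal points. *)
Lemma ex_maximal (T : finType) (a : rel T) (P : pred T) (x0 : T) :
  irreflexive a -> transitive a -> P x0 ->
  exists2 m, P m & forall z, P z -> ~~ a m z.
Proof.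
move=> a_irr a_trans Px0.
case: (arg_maxnP (fun x => #|[set y | a y x]|) Px0) => m Pm m_max.
exists m => // z Pz; apply/negP => a_mz.
have := m_max z Pz; rewrite /= leqNgt => /negP[].
apply/proper_card/properP; split.
  by apply/subsetP => y; rewrite !inE => /a_trans; apply.
by exists m; rewrite !inE // a_irr.
Qed.

(** * Orders with an acyclic Hasse diagram *)

Definition tree_order (G : sgraph) (a : rel G) : Prop :=
  transitive_orientation a /\ acyclic (hasse_graph a).

Section TreeOrder.
Variables (G : sgraph) (a : rel G).
Hypothesis a_tree : tree_order a.

Lemma tree_order_trans : transitive a.
Proof. by case: a_tree => [[]]. Qed.

Lemma tree_order_asym x y : a x y -> ~~ a y x.
Proof. by case: a_tree => [[[_ +] _] _]; apply. Qed.

Lemma tree_order_irr : irreflexive a.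
Proof. by move=> x; apply/negP => axx; move/negP: (tree_order_asym axx). Qed.

Lemma tree_order_edge x y : sedge x y = a x y || a y x.
Proof. by case: a_tree => [[[+ _] _] _]; apply. Qed.

(** Lets results about upper bounds serve for lower bounds. *)
Lemma tree_order_dual : tree_order (fun x y => a y x).
Proof.
split; first split.
- split=> [x y|x y]; first by rewrite tree_order_edge orbC.
  exact: tree_order_asym.
- by move=> y x z ayx azy; apply: tree_order_trans azy ayx.
case: a_tree => _ a_acyclic c c_gt2; rewrite /ucycle /= => c_cycle.
apply: (a_acyclic c c_gt2); rewrite /ucycle /=; move: c_cycle.
congr (_ && _); apply: eq_cycle => x y; rewrite /hasse_rel orbC /covers.
congr ((_ && ~~ _) || (_ && ~~ _)).
  by apply: eq_existsb => z; rewrite andbC.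
by apply: eq_existsb => z; rewrite andbC.
Qed.

Local Notation "x <=a y" := ((x == y) || a x y) (at level 70).

(** A saturated chain from [x] up to [y] can use the arc [(t, v)] only if [x <=a t] and [v <=a y].
    Induction on the number of points strictly between splits the chain at such a point. *)
Lemma connect_avoiding t v x y :
  a t v -> x <=a y -> ~~ ((x <=a t) && (v <=a y)) ->
  connect (delete_edge (hasse_rel a) t v) x y.
Proof.
move=> atv /orP[/eqP-> _ //|].
have [n] := ubnP #|[set z | a x z && a z y]|.
elim: n x y => // n IHn x y; rewrite ltnS => card_xy axy avoid.
have [/existsP[z /andP[axz azy]]|xy_cover] :=
  boolP [exists z, a x z && a z y]; last first.
  apply: connect1; rewrite /delete_edge /hasse_rel /covers axy xy_cover /=.
  apply/andP; split; first by apply: contra avoid => /eqP[-> ->]; rewrite !eqxx.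
  apply/eqP => -[xv yt]; move: axy; rewrite xv yt.
  exact/negP/tree_order_asym.
have smaller (x' y' : G) : [set w | a x' w && a w y'] \proper
    [set w | a x w && a w y] -> #|[set w | a x' w && a w y']| < n.
  by move/proper_card/leq_trans; apply.
apply: (connect_trans (y := z)).
  apply: IHn => //.
    apply: smaller; apply/properP; split.
      apply/subsetP => w; rewrite !inE => /andP[-> /tree_order_trans]; exact.
    by exists z; rewrite !inE ?axz ?azy // tree_order_irr andbF.
  apply: contra avoid => /andP[-> /orP[/eqP->|avz]]; first by rewrite azy orbT.
  by rewrite (tree_order_trans avz azy) orbT.
apply: IHn => //.
  apply: smaller; apply/properP; split.
    apply/subsetP => w; rewrite !inE => /andP[azw ->].
    by rewrite (tree_order_trans axz azw).
  by exists z; rewrite !inE ?axz ?azy // tree_order_irr.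
apply: contra avoid => /andP[/orP[/eqP<-|azt] ->]; first by rewrite axz orbT.
by rewrite (tree_order_trans axz azt) orbT.
Qed.

(* The arc [(t, v)] leaves the common lower bounds of [x] and [y] for the lower
   bounds of [x]; as a bridge it separates [x] from [y]. *)
Lemma separating_arc r x y :
  a r x -> a r y -> x != y -> ~~ sedge x y ->
  exists t v, [/\ r <=a t, a t x, a t y & a t v /\
    ~~ connect (delete_edge (hasse_rel a) t v) x y].
Proof.
move=> arx ary xNy; rewrite tree_order_edge negb_or => /andP[Naxy Nayx].
have [||t /and3P[rt atx aty] t_max] :=
  @ex_maximal _ a (fun t => [&& r <=a t, a t x & a t y]) r tree_order_irr.
- exact: tree_order_trans.
- by rewrite eqxx arx ary.
have [|||v /andP[atv vx] v_min] :=
  @ex_maximal _ (fun x y => a y x) (fun v => a t v && (v <=a x)) x.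
- exact: tree_order_irr.
- by move=> w u z awu azw; apply: tree_order_trans azw awu.
- by rewrite atx eqxx.
have cover_tv : covers a t v.
  rewrite /covers atv; apply/existsP => -[z /andP[atz azv]].
  have /v_min/negP[] // : a t z && (z <=a x).
  rewrite atz; case/orP: vx => [/eqP<-|avx]; first by rewrite azv orbT.
  by rewrite (tree_order_trans azv avx) orbT.
have rv : a r v.
  by case/orP: rt => [/eqP->//|art]; apply: tree_order_trans art atv.
(* Otherwise [v] is a common lower bound of [x] and [y] above [t], against the maximality of [t]. *)
have vNy : ~~ (v <=a y).
  apply/negP => vy.
  have v_ne_x : v != x.
    apply: contraTneq vy => ->; by rewrite negb_or xNy.
  have v_ne_y : v != y.
    apply: contraTneq vx => ->; by rewrite negb_or eq_sym xNy.
  move: vx vy; rewrite (negPf v_ne_x) (negPf v_ne_y) /= => avx avy.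
  by have /t_max/negP[] : [&& r <=a v, a v x & a v y]; rewrite ?rv ?orbT ?avx.
exists t, v; split=> //; split=> //; apply/negP => xy.
have e_sym : connect_sym (delete_edge (hasse_rel a) t v).
  exact/sym_connect_sym/delete_edge_sym/hasse_sym.
have := @acyclic_bridge (hasse_graph a) t v a_tree.2.
rewrite /= /hasse_rel cover_tv => /(_ isT)/negP; apply.
(* The walk [t - y - x - v] bypasses the bridge: its outer parts are chains avoiding the arc, its
   middle part is the assumed connection. *)
apply: (connect_trans (y := y)).
  by apply: connect_avoiding; rewrite ?aty ?orbT //= ?(negPf vNy) ?andbF.
apply: (connect_trans (y := x)); first by rewrite e_sym.
rewrite e_sym; apply: connect_avoiding => //.
rewrite (negPf (tree_order_asym atv)) orbF.
by apply/negP => /andP[/eqP vt _]; rewrite vt tree_order_irr in atv.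
Qed.

(** Otherwise [separating_arc] fails: the chains from [x] and [y] up to [d] start strictly above
    [t], so they avoid the arc and join [x] to [y]. *)
Lemma interval_chain r x y d :
  a r x -> a r y -> a x d -> a y d -> x != y -> sedge x y.
Proof.
move=> arx ary axd ayd xNy; apply/negPn/negP => xy.
have [t [v [_ atx aty [atv /negP[]]]]] := separating_arc arx ary xNy xy.
have above w : a t w -> a w d -> connect (delete_edge (hasse_rel a) t v) w d.
  move=> atw awd; apply: connect_avoiding; rewrite ?awd ?orbT //.
  rewrite (negPf (tree_order_asym atw)) orbF.
  by apply/negP => /andP[/eqP wt _]; rewrite wt tree_order_irr in atw.
apply: (connect_trans (y := d)); first exact: above.
rewrite sym_connect_sym; first exact: above.
exact/delete_edge_sym/hasse_sym.
Qed.

(** The tail [t] of the separating arc serves as [m] if it lies above [z]; otherwise chains from [z]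
    up to [x] and [y] avoid the arc and join its two sides. *)
Lemma between_lower_upper r z x y :
  ~~ (z <=a r) -> ~~ (r <=a z) -> x != y -> ~~ sedge x y ->
  a r x -> a z x -> a r y -> a z y ->
  exists m, [/\ a r m, a z m, a m x & a m y].
Proof.
move=> zr rz xNy xy arx azx ary azy.
have [t [v [rt atx aty [atv sep]]]] := separating_arc arx ary xNy xy.
have tNz : ~~ (t <=a z).
  apply: contra rz => tz.
  case/orP: rt tz => [/eqP-> //|art] /orP[/eqP<-|atz].
    by rewrite art orbT.
  by rewrite (tree_order_trans art atz) orbT.
have [zt|zNt] := boolP (z <=a t).
  exists t; split=> //.
    case/orP: rt => // /eqP rt; by rewrite rt zt in zr.
  case/orP: zt => // /eqP zt; by rewrite zt eqxx in tNz.
case/negP: sep; apply: (connect_trans (y := z)); last first.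
  by apply: connect_avoiding; rewrite ?azy ?orbT ?(negPf zNt).
rewrite sym_connect_sym; last exact/delete_edge_sym/hasse_sym.
by apply: connect_avoiding; rewrite ?azx ?orbT ?(negPf zNt).
Qed.
End TreeOrder.

(** * Induced copies of P4 as quadruples of vertices *)

Lemma exists_induced_iso (G H : sgraph) :
  (exists S : {set G}, iso (induced S) H) <->
  (exists f : H -> G, injective f /\ forall i j, sedge (f i) (f j) = sedge i j).
Proof.
split=> [[S [g [[h gK hK] g_edge]]]|[f [f_inj f_edge]]].
  exists (fun i => val (h i)); split=> [i j /val_inj/(can_inj hK) //|i j].
  by rewrite -{2}(hK i) -{2}(hK j) g_edge.
pose S := [set f i | i : H].
have fS i : f i \in S by apply: imset_f.
have S_inv (u : induced S) : {i | f i == val u}.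
  by apply: sigW; have /imsetP[i _ ->] := valP u; exists i.
exists S, (fun u => sval (S_inv u)); split.
  exists (fun i => exist _ (f i) (fS i)) => [u|i].
    by apply: val_inj; apply/eqP; apply: svalP (S_inv u).
  by apply: f_inj; apply/eqP; apply: svalP (S_inv _).
move=> u v; rewrite -f_edge (eqP (svalP (S_inv u))).
by rewrite (eqP (svalP (S_inv v))).
Qed.

(** These adjacencies already force the four vertices to be distinct. *)
Definition induced_P4 (G : sgraph) (w x y z : G) : Prop :=
  [/\ sedge w x, sedge x y & sedge y z] /\
  [/\ ~~ sedge w y, ~~ sedge x z & ~~ sedge w z].

Lemma exists_induced_P4 (G : sgraph) :
  (exists S : {set G}, iso (induced S) (path_graph 4)) <->
  exists w x y z : G, induced_P4 w x y z.
Proof.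
apply: (iff_trans (exists_induced_iso _ _)).
split=> [[f [_ f_edge]]|[w [x [y [z]]]]].
  exists (f (inord 0)), (f (inord 1)), (f (inord 2)), (f (inord 3)).
  by rewrite /induced_P4 !f_edge /= /path_rel !inordK.
case=> -[wx xy yz] [/negPf wy /negPf xz /negPf wz].
(* The default [w] is never reached, since [i < 4]. *)
pose f (i : 'I_4) := nth w [:: w; x; y; z] i.
have f_edge i j : sedge (f i) (f j) = path_rel i j.
  by case: i j => [[|[|[|[|//]]]] ?] [[|[|[|[|//]]]] ?]; rewrite /f /path_rel /=;
    rewrite ?sedge_irrefl ?wx ?xy ?yz ?wy ?xz ?wz // sedge_sym
            ?wx ?xy ?yz ?wy ?xz ?wz.
exists f; split=> // i j fij; apply/eqP.
(* Distinct vertices of the path have distinct neighbourhoods. *)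
have: forall k, path_rel i k = path_rel j k by move=> k; rewrite -!f_edge fij.
move=> twins; move: (twins (inord 0)) (twins (inord 1)).
move: (twins (inord 2)) (twins (inord 3)); rewrite /path_rel !inordK //.
by case: i j {fij twins} => [[|[|[|[|//]]]] ?] [[|[|[|[|//]]]] ?].
Qed.

(** * Universal vertices and P4-freeness *)

(** Two consecutive arcs in the same direction would force a chord, so directions alternate. Then
    [w, y] lie between [r] and [x], or [x, z] between [r] and [y], against [interval_chain]. *)
Lemma P4_not_above (G : sgraph) (a : rel G) (r w x y z : G) :
  tree_order a -> induced_P4 w x y z ->
  a r w -> a r x -> a r y -> a r z -> False.
Proof.
move=> a_tree [[wx xy yz] [wy xz wz]] arw arx ary arz.
have a_trans := tree_order_trans a_tree.
have edge := tree_order_edge a_tree.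
have between p q s : a p q -> a q s -> sedge p s.
  by move=> apq aqs; rewrite edge (a_trans _ _ _ apq aqs).
move: (wx) (xy) (yz); rewrite !edge.
case/orP=> [awx|axw].
  case/orP=> [axy|ayx _]; first by rewrite (between _ _ _ awx axy) in wy.
  have := interval_chain a_tree arw ary awx ayx.
  rewrite (negPf wy); case: eqP => [wEy _|_ /(_ isT)//].
  by rewrite wEy yz in wz.
case/orP=> [axy|ayx]; last by rewrite sedge_sym (between _ _ _ ayx axw) in wy.
case/orP=> [ayz|azy]; first by rewrite (between _ _ _ axy ayz) in xz.
have := interval_chain a_tree arx arz axy azy.
rewrite (negPf xz); case: eqP => [xEz _|_ /(_ isT)//].
by rewrite -xEz wx in wz.
Qed.

Lemma universal_no_P4 (G : sgraph) (a : rel G) (r w x y z : G) :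
  tree_order a -> (forall p, p != r -> sedge r p) -> ~ induced_P4 w x y z.
Proof.
move=> a_tree r_univ P4; case: (P4) => -[wx xy yz] [wy xz wz].
(* Only [r] is non-adjacent to [r]. If [r] were on the P4, following the non-edges [yw], [wz], [zx]
   would give [w = z = r], contradicting [wx] and [xz]. *)
have univ p q : ~~ sedge p q -> p = r -> q = r.
  by move=> pq pr; apply/eqP; apply: contraNT pq => /r_univ; rewrite pr.
have univ' p q : ~~ sedge p q -> q = r -> p = r.
  by rewrite sedge_sym; apply: univ.
have wNr : w != r.
  apply/eqP => wr; move: wx; rewrite wr -(univ _ _ wz wr) sedge_sym.
  exact/negP.
have zNr : z != r by apply: contra wNr => /eqP/(univ' _ _ wz)->.
have xNr : x != r by apply: contra zNr => /eqP/(univ _ _ xz)->.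
have yNr : y != r by apply: contra wNr => /eqP/(univ' _ _ wy)->.
(* Non-adjacent vertices on opposite sides of [r] would be comparable through [r]. A general [b]
   covers the dual order too. *)
have same_side (b : rel G) p q : tree_order b -> p != r -> q != r ->
    ~~ sedge p q -> b r p -> b r q.
  move=> b_tree pr qr pq brp; have := r_univ q qr.
  rewrite (tree_order_edge b_tree) => /orP[//|bqr].
  move: pq; rewrite (tree_order_edge b_tree).
  by rewrite (tree_order_trans b_tree bqr brp) orbT.
have all_above (b : rel G) : tree_order b -> b r w -> False.
  move=> b_tree brw.
  have brz := same_side b _ _ b_tree wNr zNr wz brw.
  have bry := same_side b _ _ b_tree wNr yNr wy brw.
  apply: (P4_not_above (r := r) b_tree P4) => //.
  by apply: same_side brz => //; rewrite sedge_sym.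
have := r_univ w wNr; rewrite (tree_order_edge a_tree) => /orP[|].
  exact: all_above.
exact: all_above (tree_order_dual a_tree).
Qed.

(* With a minimal common upper bound [m] of [r] and [z], every [w > r] is
   comparable to [m]: else [w - r - m - z] is an induced P4 or [w > z], and
   then a common upper bound lies below both [m] and [w]. *)
Lemma dominating_upper_bound (G : sgraph) (a : rel G) (r y z : G) :
  tree_order a -> (forall p q s t : G, ~ induced_P4 p q s t) ->
  z != r -> ~~ sedge r z -> a r y -> a z y ->
  exists m, r |: neighbors r \proper m |: neighbors m.
Proof.
move=> a_tree noP4 zNr rz ary azy.
have a_trans := tree_order_trans a_tree.
have a_irr := tree_order_irr a_tree.
have edge := tree_order_edge a_tree.
have [|||m /andP[arm azm] m_min] :=
  @ex_maximal _ (fun x y => a y x) (fun m => a r m && a z m) y.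
- exact: a_irr.
- by move=> u v w auv awu; apply: a_trans awu auv.
- by rewrite ary azy.
exists m; apply/properP; split; last first.
  by exists z; rewrite !inE ?(negPf zNr) // [sedge m z]edge azm !orbT.
apply/subsetP => w; rewrite !inE => /orP[/eqP->|].
  by rewrite [sedge m r]edge arm !orbT.
rewrite edge => /orP[arw|awr]; last first.
  by rewrite [sedge m w]edge (a_trans _ _ _ awr arm) !orbT.
apply/negPn/negP; rewrite negb_or => /andP[wNm mw].
have wz : sedge w z.
  apply/negPn/negP => wz; apply: (noP4 w r m z); split; split=> //.
  - by rewrite edge arw orbT.
  - by rewrite edge arm.
  - by rewrite edge azm orbT.
  - by rewrite sedge_sym.
have azw : a z w.
  move: wz; rewrite edge => /orP[awz|//].
  by rewrite edge (a_trans _ _ _ arw awz) in rz.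
move: rz; rewrite edge negb_or => /andP[rz zr].
have [] := between_lower_upper a_tree _ _ wNm _ arw azw arm azm.
- by rewrite (negPf zNr).
- by rewrite eq_sym (negPf zNr).
- by rewrite sedge_sym.
move=> m' [arm' azm' _ am'm].
by have /m_min/negP[] : a r m' && a z m'; rewrite ?arm'.
Qed.

Lemma P4_free_universal (G : sgraph) (a : rel G) :
  connected G -> tree_order a ->
  (forall p q s t : G, ~ induced_P4 p q s t) ->
  exists r : G, [set: G] = r |: neighbors r.
Proof.
move=> [/card_gt0P[x0 _] G_conn] a_tree noP4.
have edge := tree_order_edge a_tree.
case: (arg_maxnP (fun x : G => #|x |: neighbors x|) (erefl : predT x0)).
move=> r _ r_max; exists r; apply/esym/eqP; rewrite eqEsubset subsetT.
have not_proper m : ~ r |: neighbors r \proper m |: neighbors m.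
  by move/proper_card; have := r_max m isT; rewrite /= leqNgt => /negP.
(* By connectedness, a closed neighbourhood stable under adjacency is the whole graph. *)
have N_closed : closed sedge (mem (r |: neighbors r)).
  apply: intro_closed => [|y z yz]; first exact/sym_connect_sym/sedge_sym.
  rewrite !inE => /orP[/eqP yr|ry]; first by rewrite -yr yz orbT.
  apply/negPn/negP; rewrite negb_or => /andP[zNr rz].
  have a_trans := tree_order_trans a_tree.
  (* On the path [r - y - z], arcs in the same direction make [r] and [z] adjacent; otherwise [y] is
     a common upper or lower bound. *)
  move: (ry) (yz); rewrite !edge => /orP[ary|ayr] /orP[ayz|azy].
  - by rewrite edge (a_trans _ _ _ ary ayz) in rz.
  - have [m] := dominating_upper_bound a_tree noP4 zNr rz ary azy.
    exact: not_proper.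
  - have [m] := dominating_upper_bound (tree_order_dual a_tree) noP4 zNr rz
      ayr ayz.
    exact: not_proper.
  - by rewrite edge (a_trans _ _ _ azy ayr) orbT in rz.
apply/subsetP => w _.
by rewrite -(closed_connect N_closed (G_conn r w)) !inE eqxx.
Qed.

Theorem theorem4 (G : sgraph) (G_connected : connected G) :
  double_arborescence G <->
  (treelike_comparability_graph G /\
   ~ exists S : {set G}, iso (induced S) (path_graph 4)).
Proof.
split=> [[G_treelike [r r_univ]]|[G_treelike noP4]]; split=> //.
all: have [a [a_orient [_ a_acyclic]]] := G_treelike.
all: have a_tree : tree_order a by split.
  move=> /exists_induced_P4[w [x [y [z]]]].
  apply: (universal_no_P4 (r := r) a_tree) => p pNr.
  by have := in_setT p; rewrite r_univ !inE (negPf pNr).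
apply: (P4_free_universal G_connected a_tree) => p q s t P4.
by apply/noP4/exists_induced_P4; exists p, q, s, t.
Qed.
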